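(* Let $G$ be a twin-free triangle-free graph without isolated vertices. Then the following conditions are equivalent. (1) $G$ is CDC. (2) Every vertex of $G$ is an endpoint of a bisimplicial edge. (3) $G$ has a bisimplicial perfect matching. (4) $G$ has a unique bisimplicial perfect matching. (5) $G$ has a perfect matching and every perfect matching in $G$ is bisimplicial.
   Context: All graphs are finite, simple, undirected, with nonempty vertex set. $N(u)$ denotes the set of neighbors of $u$. Two distinct vertices $u,v$ are twins if $N(u)=N(v)$; a graph is twin-free if it has no pair of twins. A graph is triangle-free if it has no three pairwise adjacent vertices. An edge $\{u,v\}$ of $G$ is bisimplicial if every vertex in $N(u)$ is adjacent to every vertex in $N(v)$. A matching is a set of pairwise disjoint edges; it is perfect if every vertex belongs to one of its edges. A perfect matching is bisimplicial if all its edges are bisimplicial in $G$. A clique is a set of pairwise adjacent vertices; it is maximal if it is not contained in a larger clique. A clique transversal of a graph is a set of vertices containing at least one vertex from each maximal clique; it is minimal if it contains no smaller clique transversal. A hypergraph is a pair $(V,E)$ with $V$ a finite set and $E$ a set of subsets of $V$ (hyperedges) such that every vertex belongs to a hyperedge; it is conformal if every set of vertices such that any two of them belong to a common hyperedge is itself contained in a hyperedge. A graph $G$ is clique dually conformal (CDC) if the hypergraph with vertex set $V(G)$ whose hyperedges are the minimal clique transversals of $G$ is conformal. *)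

(* Defs.v *)
From mathcomp Require Import all_boot.

Set Implicit Arguments.
Unset Strict Implicit.
Unset Printing Implicit Defensive.

(* A finite simple graph is a symmetric irreflexive relation [e] on a finType
   [T]; these two properties, and the nonemptiness of [T], are hypotheses of
   the theorem and are not built into the definitions below. *)

Section Graph.

Variables (T : finType) (e : rel T).
Implicit Types (u v w x y : T) (A C S X : {set T}) (H M : {set {set T}}).

Definition neighbors u : {set T} := [set v | e u v].

Definition twins u v : bool := (u != v) && (neighbors u == neighbors v).

Definition twin_free : Prop := forall u v, ~~ twins u v.

Definition triangle_free : Prop :=
  forall u v w, ~~ [&& e u v, e v w & e u w].

Definition no_isolated : Prop := forall u, neighbors u != set0.

Definition edges : {set {set T}} :=
  [set [set u; v] | u in [set: T], v in neighbors u].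

(* The condition is symmetric in the endpoints when [e] is symmetric, so it
   does not depend on the order in which they are named. *)
Definition bisimplicial A : Prop :=
  exists u v, [/\ e u v, A = [set u; v]
                & {in neighbors u & neighbors v, forall x y, e x y}].

Definition matching M : bool := (M \subset edges) && trivIset M.

Definition perfect_matching M : bool := matching M && (cover M == [set: T]).

Definition bisimplicial_pm M : Prop :=
  perfect_matching M /\ {in M, forall A, bisimplicial A}.

Definition clique C : bool :=
  [forall u in C, forall v in C, (u != v) ==> e u v].

Definition clique_transversal X : bool :=
  [forall C : {set T}, maxset clique C ==> (X :&: C != set0)].

Definition min_clique_transversals : {set {set T}} :=
  [set X | minset clique_transversal X].

(* A hypergraph with vertex set [T] is given by its set of hyperedges. *)
Definition hypergraph H : Prop := cover H = [set: T].

Definition conformal H : Prop :=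
  forall S,
    {in S &, forall u v, u != v -> exists2 A, A \in H & (u \in A) && (v \in A)} ->
    exists2 A, A \in H & S \subset A.

Definition cdc : Prop := conformal min_clique_transversals.

(* The covering condition in the definition of a hypergraph is automatic
   here, so it need not be a conjunct of [cdc]. *)
Lemma min_clique_transversals_hypergraph : hypergraph min_clique_transversals.
Proof.
apply/setP=> v; rewrite inE; apply/bigcupP.
have cl_v : clique [set v].
  apply/forall_inP=> x /set1P->; apply/forall_inP=> y /set1P->.
  by rewrite eqxx.
have [C maxC /subsetP/(_ v (set11 v)) vC] := maxset_exists cl_v.
pose X := ~: (C :\ v).
have trX : clique_transversal X.
  apply/forall_inP=> D maxD; apply/negP=> /eqP XD0.
  have sDC : D \subset C :\ v.
    by rewrite -[C :\ v]setCK -disjoints_subset -setI_eq0 setIC XD0.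
  have DC : C = D.
    apply: (maxsetsup maxD (maxsetp maxC)).
    exact: subset_trans sDC (subsetDl _ _).
  by move: (subsetP sDC v); rewrite -DC vC !inE eqxx => /(_ isT).
have [Y minY sYX] := minset_exists trX.
exists Y; first by rewrite inE.
have /forall_inP/(_ C maxC)/set0Pn[x /setIP[xY xC]] := minsetp minY.
by move: (subsetP sYX x xY); rewrite !inE xC andbT negbK => /eqP<-.
Qed.

End Graph.

(* Main.v *)
Require Import Defs.
From mathcomp Require Import all_boot.

(** The maximal cliques of a triangle-free graph without isolated vertices are
    its edges, so clique transversals are vertex covers, and a set [S] lies in
    a minimal one exactly when some independent set dominates every vertex of
    [S] ([sub_min_clique_transversalP]).  For two adjacent vertices this says
    that the edge joining them is not bisimplicial, and the rest
    of the argument compares neighborhoods by means of the bicliques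
    [N(u) x N(v)] given by bisimplicial edges [uv].

    From (1) to (2): a closed neighborhood [N[u]] lies in no minimal vertex
    cover, because [u] is redundant there.  Conformality therefore yields two
    vertices of [N[u]] that share no minimal cover.  They cannot both be
    neighbors of [u], since [{u}] dominates these, so [u] is one of them and
    the other one spans a bisimplicial edge with [u].

    From (2) to (4): if [uv] is bisimplicial then [N(v)] is contained in
    [N(w)] for each neighbor [w] of [u] ([bisimp_sub_neighbors]).  Two
    bisimplicial edges at [u] would thus end in twins, so the bisimplicial
    edges always form a matching, and a bisimplicial perfect matching consists
    of all of them.

    From (4) to (5): let [m] and [m'] give the mates in a bisimplicial perfect
    matching and in an arbitrary one.  Then [N(m u)] is contained in [N(m' u)]
    for all [u]; as [m] and [m'] are permutations, the sums of the sizes over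
    all [u] agree, all these inclusions are equalities and [m = m'] by
    twin-freeness.

    From (5) to (1): given [S] whose vertices pairwise share a minimal cover,
    the mates of the vertices of [S] in a bisimplicial perfect matching form an
    independent set, which dominates [S]. *)

Set Implicit Arguments.
Unset Strict Implicit.
Unset Printing Implicit Defensive.

Section Graph.

Variables (T : finType) (e : rel T).
Hypotheses (e_sym : symmetric e) (e_irr : irreflexive e).
Implicit Types (u v w x y : T) (A C I S X : {set T}) (M : {set {set T}}).

(** * Minimal clique transversals as minimal vertex covers *)

Definition independent I : Prop := {in I &, forall u v, ~~ e u v}.

Definition dominates I S : Prop :=
  forall s, s \in S -> exists2 i, i \in I & e s i.

Lemma clique_edge u v : e u v -> clique e [set u; v].
Proof.
move=> uv; apply/forall_inP=> x /set2P xuv; apply/forall_inP=> y /set2P yuv.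
apply/implyP; case: xuv yuv => -> [] ->; rewrite ?eqxx // => _.
by rewrite e_sym.
Qed.

Lemma maxclique_edge u v :
  triangle_free e -> e u v -> maxset (clique e) [set u; v].
Proof.
move=> trf uv; apply/maxsetP; split; first exact: clique_edge.
move=> C /forall_inP clC sub; apply/eqP; rewrite eqEsubset sub andbT.
have [uC vC] : u \in C /\ v \in C.
  by split; apply: (subsetP sub); rewrite !inE eqxx ?orbT.
apply/subsetP=> w wC; rewrite !inE; apply/norP=> -[wu wv].
have /forall_inP/(_ w wC) := clC _ uC; rewrite eq_sym wu /= => uw.
have /forall_inP/(_ w wC) := clC _ vC; rewrite eq_sym wv /= => vw.
by have := trf u v w; rewrite uv uw vw.
Qed.

Lemma maxclique_has_edge C :
  0 < #|T| -> no_isolated e -> maxset (clique e) C ->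
  exists u v, [/\ e u v, u \in C & v \in C].
Proof.
move=> /card_gt0P[x0 _] noiso maxC.
have [x xC] : exists x, x \in C.
  have [C0|[x xC]] := set_0Vmem C; last by exists x.
  have /set0Pn[y] := noiso x0; rewrite inE => xy.
  have := maxsetsup maxC (clique_edge xy); rewrite C0 sub0set => /(_ isT) E.
  by have := set21 x0 y; rewrite E inE.
have /set0Pn[y] := noiso x; rewrite inE => xy.
have [Cx|] := boolP (C \subset [set x]).
  have sub : C \subset [set x; y] by apply: subset_trans Cx (subsetUl _ _).
  exists x, y; split=> //.
  by rewrite -(maxsetsup maxC (clique_edge xy) sub) set22.
case/subsetPn=> z zC; rewrite inE eq_sym => xz.
exists x, z; split=> //.
by have /forall_inP/(_ x xC)/forall_inP/(_ z zC)/implyP/(_ xz) := maxsetp maxC.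
Qed.

Lemma clique_transversalP X :
  0 < #|T| -> triangle_free e -> no_isolated e ->
  reflect (forall u v, e u v -> (u \in X) || (v \in X))
          (clique_transversal e X).
Proof.
move=> T0 trf noiso; apply: (iffP forall_inP) => [trX u v uv|covX C maxC].
  have /set0Pn[x /setIP[xX /set2P xuv]] := trX _ (maxclique_edge trf uv).
  by case: xuv xX => -> ->; rewrite ?orbT.
have [u [v [uv uC vC]]] := maxclique_has_edge T0 noiso maxC.
by apply/set0Pn; case/orP: (covX u v uv) => ?; [exists u|exists v]; apply/setIP.
Qed.

(** In a minimal vertex cover every vertex has a neighbor outside, and the
    outside is independent.  Conversely, a vertex cover that avoids an
    independent set must contain all the vertices that this set dominates, so
    any minimal cover inside the complement of the independent set will do. *)
Lemma sub_min_clique_transversalP S :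
  0 < #|T| -> triangle_free e -> no_isolated e ->
  (exists2 A, A \in min_clique_transversals e & S \subset A) <->
  (exists2 I, independent I & dominates I S).
Proof.
move=> T0 trf noiso; have trP X := clique_transversalP X T0 trf noiso.
split=> [[A]|[I indI domS]].
  rewrite inE => minA /subsetP SA; have /trP covA := minsetp minA.
  exists (~: A) => [u v|s /SA sA].
    by rewrite !inE => uA vA; apply/negP=> /covA; rewrite (negPf uA) (negPf vA).
  apply/exists_inP; apply: contraT; rewrite negb_exists_in => /forall_inP nsA.
  have sN v : e s v -> v \in A.
    by move=> sv; apply: contraTT sv => vA; apply: nsA; rewrite inE.
  have trAs : clique_transversal e (A :\ s).
    apply/trP=> u v uv; rewrite !inE.
    have [us|us] := eqVneq u s; have [vs|vs] := eqVneq v s => /=.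
    - by rewrite us vs e_irr in uv.
    - by apply: sN; rewrite -us.
    - by rewrite orbF; apply: sN; rewrite e_sym -vs.
    - exact: covA.
  have /setP/(_ s) := minsetinf minA trAs (subsetDl _ _).
  by rewrite !inE eqxx sA.
have trI : clique_transversal e (~: I).
  apply/trP=> u v uv; rewrite !inE -negb_and.
  by apply: contraL uv => /andP[uI vI]; apply: indI.
have [Y minY /subsetP YI] := minset_exists trI.
exists Y; first by rewrite inE.
apply/subsetP=> s /domS[i iI si].
have /trP/(_ s i si) := minsetp minY.
by case/orP=> // /YI; rewrite inE iI.
Qed.

(** * Bisimplicial edges *)

Definition bisimp u v : bool :=
  e u v && [forall x in neighbors e u, forall y in neighbors e v, e x y].

Lemma bisimpP u v :
  reflect (e u v /\ forall x y, e u x -> e v y -> e x y) (bisimp u v).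
Proof.
apply: (iffP andP) => -[uv bis]; split=> //.
  move=> x y ux vy.
  have /forall_inP/(_ x) := bis; rewrite inE => /(_ ux)/forall_inP; apply.
  by rewrite inE.
apply/forall_inP=> x; rewrite inE => ux.
by apply/forall_inP=> y; rewrite inE; apply: bis.
Qed.

Lemma bisimp_sym u v : bisimp u v -> bisimp v u.
Proof.
case/bisimpP=> uv bis; apply/bisimpP; split; first by rewrite e_sym.
by move=> x y vx uy; rewrite e_sym; apply: bis.
Qed.

Lemma bisimplicialP A :
  bisimplicial e A <-> exists u v, A = [set u; v] /\ bisimp u v.
Proof.
split=> [[u [v [uv -> bis]]]|[u [v [-> /bisimpP[uv bis]]]]]; exists u, v.
  by split=> //; apply/bisimpP; split=> // x y ux vy; apply: bis; rewrite inE.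
by split=> // x y; rewrite !inE; apply: bis.
Qed.

Lemma bisimplicial_endpoint A u :
  bisimplicial e A -> u \in A -> exists2 v, A = [set u; v] & bisimp u v.
Proof.
case/bisimplicialP=> x [y [-> xy]] /set2P[]->; first by exists y.
by exists x; [rewrite setUC | apply: bisimp_sym].
Qed.

Lemma bisimp_sub_neighbors u v w :
  bisimp u v -> e u w -> neighbors e v \subset neighbors e w.
Proof.
by case/bisimpP=> _ bis uw; apply/subsetP=> y; rewrite !inE; apply: bis.
Qed.

Lemma twin_free_inj : twin_free e -> injective (neighbors e).
Proof.
move=> tf u v Nuv; apply/eqP; apply: contraT => uv.
by have := tf u v; rewrite /twins uv Nuv eqxx.
Qed.

(** The ends of two bisimplicial edges at [u] would have neighborhoods included
    in each other, hence would be twins. *)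
Lemma bisimp_unique u v w : twin_free e -> bisimp u v -> bisimp u w -> v = w.
Proof.
move=> tf uv uw; apply: (twin_free_inj tf); apply/eqP; rewrite eqEsubset.
have [[euv _] [euw _]] := (bisimpP _ _ uv, bisimpP _ _ uw).
by rewrite (bisimp_sub_neighbors uv euw) (bisimp_sub_neighbors uw euv).
Qed.

(** * Perfect matchings and their mate functions *)

Lemma perfect_matching_mate M :
  perfect_matching e M ->
  exists m : T -> T, [/\ involutive m, forall u, e u (m u)
                       & M = [set [set u; m u] | u in [set: T]]].
Proof.
case/andP=> /andP[/subsetP Medges triv] /eqP covM.
have uM u : exists v, e u v /\ [set u; v] \in M.
  have : u \in cover M by rewrite covM inE.
  case/bigcupP=> A AM; have /imset2P[x y _] := Medges A AM.
  rewrite inE => xy Axy; rewrite Axy in AM *.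
  case/set2P=> ->; first by exists y.
  by exists x; rewrite e_sym setUC.
have [m mP] := fin_all_exists uM; exists m.
have blockM A u : A \in M -> u \in A -> A = [set u; m u].
  move=> AM uA; rewrite -(def_pblock triv AM uA).
  by have [_ muM] := mP u; rewrite (def_pblock triv muM (set21 _ _)).
split=> [u|u|].
- have [_ muM] := mP u; have E := blockM _ (m u) muM (set22 _ _).
  have : m (m u) \in [set u; m u] by rewrite E set22.
  case/set2P=> // mmu; have [] := mP (m u).
  by rewrite mmu e_irr.
- by have [] := mP u.
apply/setP=> A; apply/idP/imsetP=> [AM|[u _ ->]]; last by have [] := mP u.
have /imset2P[x y _ _ Axy] := Medges A AM.
by exists x => //; apply: blockM => //; rewrite Axy set21.
Qed.

Lemma bisimplicial_pm_mate M :
  bisimplicial_pm e M ->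
  exists m : T -> T, [/\ involutive m, forall u, bisimp u (m u)
                       & M = [set [set u; m u] | u in [set: T]]].
Proof.
case=> pmM bisM; have [m [invm em Mm]] := perfect_matching_mate pmM.
exists m; split=> // u.
have /bisM bisu : [set u; m u] \in M by rewrite Mm; apply: imset_f.
have [v E uv] := bisimplicial_endpoint bisu (set21 _ _).
have : m u \in [set u; v] by rewrite -E set22.
by case/set2P=> mu; [have := em u; rewrite mu e_irr | rewrite mu].
Qed.

Lemma mem_bisimplicial_pm M A :
  twin_free e -> bisimplicial_pm e M -> A \in M <-> bisimplicial e A.
Proof.
move=> tf bpM; split; first by case: bpM => _; apply.
case/bisimplicialP=> u [v [-> uv]].
have [m [_ bm ->]] := bisimplicial_pm_mate bpM.
by rewrite (bisimp_unique tf uv (bm u)); apply: imset_f.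
Qed.

(** * The implications *)

Lemma cdc_bisimplicial_cover :
  0 < #|T| -> triangle_free e -> no_isolated e -> cdc e ->
  forall u, exists2 A, bisimplicial e A & u \in A.
Proof.
move=> T0 trf noiso cdce u.
have subP S := sub_min_clique_transversalP S T0 trf noiso.
have [v uv|nbis] := pickP (bisimp u).
  exists [set u; v]; last exact: set21.
  by apply/bisimplicialP; exists u, v.
(* An edge at [u] that is not bisimplicial is dominated by two non-adjacent
   neighbors of its ends. *)
have pair v : e u v -> exists2 A, A \in min_clique_transversals e
                                & [set u; v] \subset A.
  move=> uv; apply/subP; move/negbT: (nbis v); rewrite /bisimp uv /=.
  case/forall_inPn=> x; rewrite inE => ux /forall_inPn[y].
  rewrite inE => vy nxy; exists [set x; y].
    by move=> a b /set2P[]-> /set2P[]->; rewrite ?e_irr // e_sym.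
  by move=> s /set2P[]->; [exists x|exists y]; rewrite ?set21 ?set22.
have [|A AM /subsetP NA] := cdce (u |: neighbors e u).
  move=> x y /setU1P xN /setU1P yN xy.
  suff [A AM /subsetP xyA] : exists2 A, A \in min_clique_transversals e
                                      & [set x; y] \subset A.
    by exists A => //; rewrite !xyA ?set21 ?set22.
  case: xN xy => [->|]; case: yN => [->|]; rewrite ?inE ?eqxx //.
  - by move=> uy _; apply: pair.
  - by move=> ux _; rewrite setUC; apply: pair.
  move=> uy ux _; apply/subP; exists [set u] => [a b /set1P-> /set1P->|s].
    by rewrite e_irr.
  by case/set2P=> ->; exists u; rewrite ?set11 // e_sym.
have NsubA : u |: neighbors e u \subset A by apply/subsetP.
have [I indI domI] := (subP (u |: neighbors e u)).1 (ex_intro2 _ _ A AM NsubA).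
have [i iI ui] := domI u (setU11 _ _).
have [|j jI ij] := domI i; first by rewrite !inE ui orbT.
by have := indI i j iI jI; rewrite ij.
Qed.

Lemma bisimplicial_cover_pm :
  twin_free e -> (forall u, exists2 A, bisimplicial e A & u \in A) ->
  exists M, bisimplicial_pm e M.
Proof.
move=> tf cov.
have ex u : exists v, bisimp u v.
  have [A bisA uA] := cov u.
  by have [v _] := bisimplicial_endpoint bisA uA; exists v.
have [m bm] := fin_all_exists ex.
have invm : involutive m.
  by move=> u; apply: (bisimp_unique tf (bm (m u))); apply: bisimp_sym.
exists [set [set u; m u] | u in [set: T]]; split; last first.
  by move=> A /imsetP[u _ ->]; apply/bisimplicialP; exists u, (m u).
apply/andP; split; [apply/andP; split|].
- apply/subsetP=> A /imsetP[u _ ->]; apply/imset2P; exists u (m u) => //.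
  by rewrite inE; have /bisimpP[] := bm u.
- have block u w : w \in [set u; m u] -> [set u; m u] = [set w; m w].
    by case/set2P=> ->; rewrite ?invm // setUC.
  apply/trivIsetP=> A B /imsetP[u _ ->] /imsetP[v _ ->]; apply: contraR.
  by rewrite -setI_eq0 => /set0Pn[w /setIP[/block-> /block->]].
- apply/eqP/setP=> u; rewrite inE; apply/bigcupP.
  by exists [set u; m u]; [apply: imset_f | apply: set21].
Qed.

Lemma bisimplicial_pm_unique M M' :
  twin_free e -> bisimplicial_pm e M -> bisimplicial_pm e M' -> M = M'.
Proof.
move=> tf bM bM'; apply/setP=> A.
have [toB' ofB'] := mem_bisimplicial_pm A tf bM'.
have [toB ofB] := mem_bisimplicial_pm A tf bM.
by apply/idP/idP=> [/toB/ofB'|/toB'/ofB].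
Qed.

(** Passing from [m] to [m'] can only enlarge the neighborhood of the mate,
    while both families of mates run over all vertices; so no neighborhood
    changes at all. *)
Lemma perfect_matching_eq_bisimplicial_pm M M' :
  twin_free e -> bisimplicial_pm e M -> perfect_matching e M' -> M' = M.
Proof.
move=> tf /bisimplicial_pm_mate[m [invm bm ->]].
case/perfect_matching_mate=> m' [invm' em' ->].
have leN u : #|neighbors e (m u)| <= #|neighbors e (m' u)|
             ?= iff (neighbors e (m u) == neighbors e (m' u)).
  exact: subset_leqif_cards (bisimp_sub_neighbors (bm u) (em' u)).
have [_] := leqif_sum (P := xpredT) (fun u _ => leN u).
pose deg w := #|neighbors e w|.
rewrite -(reindex_inj (F := deg) (P := xpredT) (inv_inj invm)).
rewrite -(reindex_inj (F := deg) (P := xpredT) (inv_inj invm')) eqxx.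
move/esym/forallP=> eqN; apply: eq_imset => u.
by rewrite (twin_free_inj tf (eqP (eqN u))).
Qed.

(** If [m s] and [m t] are adjacent, the bicliques around [s (m s)] and
    [t (m t)] make every neighbor of [s] adjacent to every neighbor of [t], so
    that [s] and [t] share no minimal clique transversal. *)
Lemma bisimplicial_pm_cdc M :
  0 < #|T| -> triangle_free e -> no_isolated e -> bisimplicial_pm e M -> cdc e.
Proof.
move=> T0 trf noiso /bisimplicial_pm_mate[m [invm bm _]] S pairS.
have subP X := sub_min_clique_transversalP X T0 trf noiso.
apply/subP; exists (m @: S); last first.
  move=> s sS.
  by exists (m s); [apply: imset_f | have /bisimpP[] := bm s].
move=> _ _ /imsetP[s sS ->] /imsetP[t tS ->].
have [->|st] := eqVneq s t; first by rewrite e_irr.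
have [A AM /andP[sA tA]] := pairS s t sS tS st.
have stA : [set s; t] \subset A by rewrite subUset !sub1set sA.
have [I indI domI] := (subP [set s; t]).1 (ex_intro2 _ _ A AM stA).
have [x xI sx] := domI s (set21 _ _); have [y yI ty] := domI t (set22 _ _).
apply: contra (indI x y xI yI) => mst.
have /bisimpP[_ bis_s] := bm s; have /bisimpP[_ bis_t] := bm t.
by rewrite e_sym; apply: bis_t => //; rewrite e_sym; apply: bis_s.
Qed.

End Graph.

Theorem theorem6p14 (T : finType) (e : rel T) (nonempty : 0 < #|T|)
    (e_sym : symmetric e) (e_irr : irreflexive e)
    (twin_free_e : twin_free e) (triangle_free_e : triangle_free e)
    (no_isolated_e : no_isolated e) :
  [<-> cdc e;
       forall u : T, exists2 A, bisimplicial e A & u \in A;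
       exists M, bisimplicial_pm e M;
       exists! M, bisimplicial_pm e M;
       (exists M, perfect_matching e M) /\
         (forall M, perfect_matching e M -> bisimplicial_pm e M)].
Proof.
tfae.
- exact: cdc_bisimplicial_cover.
- exact: bisimplicial_cover_pm.
- by case=> M bM; exists M; split=> // M'; apply: bisimplicial_pm_unique.
- case=> M [bM _]; split; first by exists M; case: bM.
  have eqM := perfect_matching_eq_bisimplicial_pm e_sym e_irr twin_free_e bM.
  by move=> M' /eqM->.
- by case=> -[M pM] /(_ M pM); apply: bisimplicial_pm_cdc.
Qed.
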